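(* Let $n\ge 1$ and let $\mathcal{T}_n=(T_n,\emptyset)$, where $T_n$ is the diagonal triangulation of the square with $n$ interior vertices, with area variables $A_1,\dots,A_{n+1},B_1,\dots,B_{n+1}$ as in the context. For $0\le k\le n+1$ let $L_k=\sum_{i=1}^k(A_i+B_i)-\sum_{i=k+1}^{n+1}(A_i+B_i)$, and let $L_{k_1k_2\cdots k_j}=\prod_{i=1}^jL_{k_i}$ (the empty product being $1$). Then the Monsky polynomial $p(\mathcal{T}_n)$ is equal (up to sign) to $$L_{12\cdots n}-2\left(A_1L_{23\cdots n}+A_2L_{34\cdots n0}+\cdots+A_nL_{01\cdots(n-2)}-A_{n+1}L_{12\cdots(n-1)}\right),$$ that is, to $$\prod_{j=1}^nL_j-2\left(\sum_{i=1}^nA_i\prod_{\substack{0\le j\le n\\ j\ne i-1,i}}L_j-A_{n+1}\prod_{j=1}^{n-1}L_j\right).$$ In particular, $\deg(\mathcal{T}_n)=n$.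
   Context: The triangulation $T_n$ is the simplicial complex (homeomorphic to a disk) with four corners $P=p_0$, $Q$, $R=p_{n+1}$, $S$ in cyclic order, interior vertices $p_1,\dots,p_n$, and the $2n+2$ triangles $\{S,p_{i-1},p_i\}$ and $\{Q,p_i,p_{i-1}\}$ for $1\le i\le n+1$. (In coordinates the square has $P=(0,0)$, $Q=(t,0)$, $R=(t,t)$, $S=(0,t)$; the interior points are not constrained to lie on the diagonal.) The variable $A_i$ corresponds to (twice) the signed area of the oriented triangle $(S,p_{i-1},p_i)$ and $B_i$ to (twice) the signed area of the oriented triangle $(Q,p_i,p_{i-1})$, where the area of an oriented triangle with vertices $(x_i,y_i)$, $i=1,2,3$, is half the determinant with rows $(1,1,1),(x_1,x_2,x_3),(y_1,y_2,y_3)$. The notation $(T_n,\emptyset)$ means that no collinearity condition is imposed. Monsky polynomial: let $(z_1,z_2,z_3,z_4)$ be the vertices, in cyclic order, of a nondegenerate parallelogram. Let $X$ be the set of maps $\rho:\mathrm{Vert}(T_n)\to\mathbb{C}^2$ for which there is a (not necessarily invertible) affine map $\phi$ of $\mathbb{C}^2$ with $\rho(P)=\phi(z_1),\rho(Q)=\phi(z_2),\rho(R)=\phi(z_3),\rho(S)=\phi(z_4)$. Let $Y$ be the complex projective space with one homogeneous coordinate for each triangle of $T_n$, and let $V(\mathcal{T}_n)\subset Y$ be the Zariski closure of the image of the rational map $X\dashrightarrow Y$ sending $\rho$ to the tuple of signed areas of the image triangles. $V(\mathcal{T}_n)$ is an irreducible hypersurface; $p(\mathcal{T}_n)$ is the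 irreducible homogeneous polynomial vanishing on it, scaled to have integer coefficients with no common factor (well-defined up to sign), and $\deg(\mathcal{T}_n)=\deg p(\mathcal{T}_n)$. *)

(* Defs.v *)
From mathcomp Require Import all_boot all_order all_algebra.
From mathcomp Require Import mpoly complex reals.

Set Implicit Arguments.
Unset Strict Implicit.
Unset Printing Implicit Defensive.

Import GRing.Theory.

Local Open Scope ring_scope.
Local Open Scope complex_scope.

(* The corners p_0 and p_{n+1} are P and R; Q and S are the other two. *)
Inductive vertex (n : nat) := p_ of 'I_n.+2 | cornerQ | cornerS.

Arguments cornerQ {n}.
Arguments cornerS {n}.

Definition cornerP {n} : vertex n := p_ ord0.
Definition cornerR {n} : vertex n := p_ ord_max.

(* The triangles of T_n, oriented, indexed from 0: for i : 'I_n.+1, index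
   lshift _ i gives (S, p_i, p_{i+1}) and index rshift _ i gives
   (Q, p_{i+1}, p_i). *)
Definition ntriangles (n : nat) : nat := n.+1 + n.+1.

Definition triangle n (t : 'I_(ntriangles n)) :
    vertex n * vertex n * vertex n :=
  match split t with
  | inl i => (cornerS, p_ (widen_ord (leqnSn n.+1) i), p_ (lift ord0 i))
  | inr i => (cornerQ, p_ (lift ord0 i), p_ (widen_ord (leqnSn n.+1) i))
  end.

Section Geometry.
Variable K : realType.
Local Notation C := (K[i]).

Definition signed_area (u v w : 'cV[C]_2) : C :=
  \det (col_mx (const_mx 1 : 'rV_3) (row_mx u (row_mx v w)) : 'M_3) / 2.

(* Opposite sides agree, and the vertices are not collinear. *)
Definition nondegenerate_parallelogram (z1 z2 z3 z4 : 'cV[C]_2) : Prop :=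
  z2 - z1 = z3 - z4 /\ signed_area z1 z2 z3 != 0.

Section Drawings.
Variables (n : nat) (z1 z2 z3 z4 : 'cV[C]_2).

(* The affine map v |-> M v + b may be singular. *)
Definition drawing (rho : vertex n -> 'cV[C]_2) : Prop :=
  exists (M : 'M[C]_2) (b : 'cV[C]_2),
    [/\ rho cornerP = M *m z1 + b, rho cornerQ = M *m z2 + b,
        rho cornerR = M *m z3 + b & rho cornerS = M *m z4 + b].

Definition areas (rho : vertex n -> 'cV[C]_2) (t : 'I_(ntriangles n)) : C :=
  let: (u, v, w) := triangle t in signed_area (rho u) (rho v) (rho w).

(* Points of the projective space Y are given by their nonzero vectors of
   homogeneous coordinates; the rational map X --> Y is defined at rho when
   the areas of rho are not all zero. *)
Definition proj_point (y : 'I_(ntriangles n) -> C) : Prop :=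
  exists t, y t != 0.

Definition area_image (y : 'I_(ntriangles n) -> C) : Prop :=
  proj_point y /\
  exists rho (c : C), [/\ drawing rho, c != 0 & forall t, y t = c * areas rho t].

Definition zariski_closure (U : ('I_(ntriangles n) -> C) -> Prop)
    (y : 'I_(ntriangles n) -> C) : Prop :=
  proj_point y /\
  forall (d : nat) (q : {mpoly C[ntriangles n]}), q \is d.-homog ->
    (forall x, U x -> q.@[x] = 0) -> q.@[y] = 0.

Definition area_variety : ('I_(ntriangles n) -> C) -> Prop :=
  zariski_closure area_image.

End Drawings.

Definition irreducible_mpoly m (q : {mpoly C[m]}) : Prop :=
  [/\ q != 0, q \isn't a GRing.unit &
      forall q1 q2 : {mpoly C[m]}, q = q1 * q2 ->
        q1 \is a GRing.unit \/ q2 \is a GRing.unit].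

Definition primitive_mpoly m (q : {mpoly int[m]}) : Prop :=
  forall d : int, (forall e : 'X_{1..m}, (d %| q@_e)%Z) -> d \is a GRing.unit.

(* Irreducibility is over the complex numbers. *)
Definition is_monsky_polynomial n (z1 z2 z3 z4 : 'cV[C]_2)
    (q : {mpoly int[ntriangles n]}) : Prop :=
  let qC : {mpoly C[ntriangles n]} := map_mpoly intr q in
  [/\ exists d : nat, q \is d.-homog,
      irreducible_mpoly qC,
      forall y, area_variety z1 z2 z3 z4 y -> qC.@[y] = 0
    & primitive_mpoly q].

End Geometry.

(* The 1-based variables A_i and B_i, meaningful for 1 <= i <= n + 1. *)
Definition varA n (i : nat) : {mpoly int[ntriangles n]} :=
  'X_(lshift n.+1 (inord i.-1 : 'I_n.+1)).

Definition varB n (i : nat) : {mpoly int[ntriangles n]} :=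
  'X_(rshift n.+1 (inord i.-1 : 'I_n.+1)).

Definition formL n (k : nat) : {mpoly int[ntriangles n]} :=
  \sum_(1 <= i < k.+1) (varA n i + varB n i)
  - \sum_(k.+1 <= i < n.+2) (varA n i + varB n i).

(* Main.v *)
(** In coordinates centred at the centre of the parallelogram, let [q] be the
    position of [Q] and [w_i] that of [p_i]. The form [L_i] is proportional to
    [[q, w_i]], so the three-term Pluecker relation among [w_{i-1} + q],
    [w_i + q], [q] and an auxiliary vector [X] reads
    [d A_i = L_i xi_{i-1} - L_{i-1} xi_i] with [xi_i = [w_i + q, X]]. After
    multiplication by the missing factors [L_j] the sum over [i] telescopes, and
    what remains is the vanishing of the polynomial [f]. Conversely, where no
    [L_j] vanishes the relation can be solved recursively for [xi], and [f = 0]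
    is exactly the condition that the recursion ends at the corner [R].

    [A_1, ..., A_{n+1}, L_0, ..., L_n] are linear coordinates, in which [f] has
    degree one in [A_{n+1}] with leading coefficient [2 L_1 ... L_{n-1}]. The
    [L_j] are prime and, for [0 < j < n], do not divide [f], so [f] is
    irreducible, and pseudo-division by [f] in [A_{n+1}] shows that it divides
    every polynomial vanishing at the area vectors. At the point
    [B_1 = 1], all other variables zero, [f] takes the value [1]; hence [f] is
    primitive. *)

Require Import Defs.
From mathcomp Require Import all_boot all_order all_algebra.
From mathcomp Require Import mpoly complex reals.
From mathcomp Require Import ring zify.

Set Implicit Arguments.
Unset Strict Implicit.
Unset Printing Implicit Defensive.

Import GRing.Theory Num.Theory.

Local Open Scope ring_scope.

(** * The form as a function of two sequences, and its telescoping *)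

Definition monsky_form (R : comNzRingType) (n : nat) (a L : nat -> R) : R :=
  \prod_(1 <= j < n.+1) L j
  - 2 * (\sum_(1 <= i < n.+1)
           a i * (\prod_(0 <= j < n.+1 | (j != i.-1) && (j != i)) L j)
         - a n.+1 * \prod_(1 <= j < n) L j).

Lemma prod_skip2 (R : comNzRingType) (n i : nat) (L : nat -> R) : (0 < i <= n)%N ->
  \prod_(0 <= j < n.+1 | (j != i.-1) && (j != i)) L j =
  \prod_(0 <= j < i.-1) L j * \prod_(i.+1 <= j < n.+1) L j.
Proof.
case: i => // i /= le_in.
rewrite (@big_cat_nat _ _ _ i) //=; last by lia.
congr (_ * _).
  rewrite big_nat_cond [RHS]big_nat_cond; apply: eq_bigl => j; lia.
rewrite !(@big_ltn_cond _ _ _ i) ?(@big_ltn_cond _ _ _ i.+1) //; last by lia.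
rewrite !eqxx /= andbF; rewrite big_nat_cond [RHS]big_nat_cond.
by apply: eq_bigl => j; lia.
Qed.

(** Multiplied by the missing [L j], the relation for [i] reads [xi_{i-1} prod_{j <> i-1} L_j - xi_i
    prod_{j <> i} L_j] on the right, a difference of consecutive terms. *)
Lemma telescoping_sum (R : comNzRingType) (n : nat) (d : R) (a L xi : nat -> R) :
  (forall i, (0 < i <= n)%N -> d * a i = L i * xi i.-1 - L i.-1 * xi i) ->
  d * (\sum_(1 <= i < n.+1)
         a i * (\prod_(0 <= j < n.+1 | (j != i.-1) && (j != i)) L j)) =
  xi 0%N * \prod_(1 <= j < n.+1) L j - xi n * \prod_(0 <= j < n) L j.
Proof.
elim: n => [|n IHn] da; first by rewrite !big_geq // mulr0 subrr.
have /IHn{}IHn : forall i, (0 < i <= n)%N -> d * a i = L i * xi i.-1 - L i.-1 * xi i.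
  by move=> i i_n; apply: da; lia.
rewrite big_nat_recr // mulrDr mulrA da ?leqnn // (@prod_skip2 _ _ n.+1) ?leqnn //=.
rewrite [\prod_(n.+2 <= j < n.+2) _]big_geq // mulr1.
(* Passing from [n] to [n.+1] gives every earlier term the factor [L n.+1], which is pulled out
   before the induction hypothesis is used. *)
under eq_big_nat => i i_n.
  rewrite prod_skip2; last by lia.
  rewrite big_nat_recr /=; last by lia.
  rewrite !mulrA -[_ * _ * \prod_(_ <= _ < _) _]mulrA -prod_skip2; last by lia.
  over.
rewrite -big_distrl /= mulrA IHn.
rewrite [\prod_(1 <= j < n.+2) _]big_nat_recr //= [\prod_(0 <= j < n.+1) _]big_nat_recr //=.
ring.
Qed.

(** Since [L_{n+1} = - L_0], the relation at [n.+1] cancels the boundary term [xi_n L_0 ... L_{n-1}]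
    of the telescoped sum and leaves [xi_{n+1} L_1 ... L_n]. The identity serves both directions:
    for a drawing the last factor is zero, and at a root where no [L j] vanishes it is forced to be
    zero. *)
Lemma monsky_form_telescope (R : comNzRingType) (n : nat) (d : R) (a L xi : nat -> R) :
    (0 < n)%N -> L n.+1 = - L 0%N ->
    (forall i, (0 < i <= n.+1)%N -> d * a i = L i * xi i.-1 - L i.-1 * xi i) ->
  d * monsky_form n a L =
  \prod_(1 <= j < n.+1) L j * (d - 2 * (xi 0%N + xi n.+1)).
Proof.
case: n => // n _ Ln da; rewrite /monsky_form mulrBr mulrCA mulrBr.
rewrite (telescoping_sum (xi := xi)); last first.
  by move=> i i_n; apply: da; lia.
rewrite [d * (_ * _)]mulrA da ?leqnn //= Ln.
rewrite [\prod_(0 <= j < n.+1) _]big_ltn // ![\prod_(1 <= j < n.+2) _]big_nat_recr //=.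
ring.
Qed.

Lemma monsky_form_a0 (R : comNzRingType) n (L : nat -> R) :
  monsky_form n (fun=> 0) L = \prod_(1 <= j < n.+1) L j.
Proof.
rewrite /monsky_form mul0r subr0 [\sum_(_ <= i < _) _]big1 ?mulr0 ?subr0 // => i _.
by rewrite mul0r.
Qed.

Lemma rmorph_monsky_form (R S : comNzRingType) (g : {rmorphism R -> S}) n (a L : nat -> R) :
  g (monsky_form n a L) = monsky_form n (g \o a) (g \o L).
Proof.
rewrite /monsky_form rmorphB rmorphM rmorphB rmorphM rmorph_nat !rmorph_prod rmorph_sum.
congr (_ - _ * (_ - _)); apply: eq_bigr => i _.
by rewrite rmorphM rmorph_prod.
Qed.

Lemma eq_monsky_form (R : comNzRingType) n (a a' L L' : nat -> R) :
    (forall i, (0 < i <= n.+1)%N -> a i = a' i) ->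
    (forall j, (j <= n)%N -> L j = L' j) ->
  monsky_form n a L = monsky_form n a' L'.
Proof.
move=> eqa eqL; rewrite /monsky_form; congr (_ - 2 * (_ - _)).
- by apply: eq_big_nat => j j_n; apply: eqL; lia.
- apply: eq_big_nat => i i_n; rewrite eqa; last by lia.
  congr (_ * _); rewrite big_nat_cond [RHS]big_nat_cond.
  by apply: eq_bigr => j j_n; apply: eqL; lia.
- rewrite eqa ?leqnn //; congr (_ * _).
  by apply: eq_big_nat => j j_n; apply: eqL; lia.
Qed.

(** * Substitution, and polynomials vanishing at all points *)

Section Substitution.
Variables (n : nat) (R : nzRingType).

Lemma rmorph_mmap (S T : nzRingType) (g : {rmorphism S -> T}) (f : R -> S) h
    (p : {mpoly R[n]}) :
  g (mmap f h p) = mmap (g \o f) (g \o h) p.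
Proof.
rewrite /mmap rmorph_sum; apply: eq_bigr => m _; rewrite rmorphM /mmap1 rmorph_prod.
by congr (_ * _); apply: eq_bigr => i _; rewrite rmorphXn.
Qed.

Lemma eq_mmap (S : nzRingType) (f f' : R -> S) h h' (p : {mpoly R[n]}) :
  f =1 f' -> h =1 h' -> mmap f h p = mmap f' h' p.
Proof.
move=> eqf eqh; apply: eq_bigr => m _; rewrite eqf; congr (_ * _).
by apply: eq_bigr => i _; rewrite eqh.
Qed.

Lemma mmap_id (p : {mpoly R[n]}) : mmap (@mpolyC n R) (fun i => 'X_i) p = p.
Proof.
rewrite [RHS]mpolyE /mmap; apply: eq_bigr => m _.
by rewrite mmap1_id mul_mpolyC.
Qed.
End Substitution.

Lemma poly_natroots (R : idomainType) (p : {poly R}) :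
  [pchar R] =i pred0 -> (forall k : nat, p.[k%:R] = 0) -> p = 0.
Proof.
move=> charR pk; apply/eqP; apply: contraT => p_neq0.
have /(max_poly_roots p_neq0): all (root p) [seq k%:R | k <- iota 0 (size p)].
  by apply/allP => _ /mapP[k _ ->]; apply/rootP.
rewrite map_inj_uniq ?iota_uniq; last first.
  have inj_le i j : (i <= j)%N -> i%:R = j%:R :> R -> i = j.
    move=> le_ij /eqP; rewrite eq_sym -subr_eq0 -natrB //.
    by rewrite ((pcharf0P _).1 charR) => ?; lia.
  move=> i j eq_ij; case/orP: (leq_total i j) => le_ij; first exact: inj_le.
  by apply/esym/inj_le.
by move=> /(_ isT); rewrite size_map size_iota ltnn.
Qed.

(** Values are turned back into variables one at a time. With the variables below [k] free and those
    above [k] specialised, [p] becomes a univariate polynomial [P] in the variable [k], which by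
    induction vanishes at every natural number. *)
Lemma meval_eq0 (n : nat) (R : idomainType) (p : {mpoly R[n]}) :
  [pchar R] =i pred0 -> (forall v, p.@[v] = 0) -> p = 0.
Proof.
move=> charR pv0.
have charS : [pchar {mpoly R[n]}] =i pred0.
  apply/(pcharf0P) => k.
  by rewrite -(rmorph_nat (@mpolyC n R)) mpolyC_eq0 ((pcharf0P _).1 charR).
suff part k : (k <= n)%N -> forall v : 'I_n -> R,
    mmap (@mpolyC n R) (fun i : 'I_n => if (i < k)%N then 'X_i else (v i)%:MP) p = 0.
  rewrite -[LHS]mmap_id -[RHS](part n (leqnn n) (fun=> 0)).
  by apply: eq_mmap => // i; rewrite ltn_ord.
elim: k => [|k IHk] k_n v.
  rewrite -[RHS](rmorph0 (@mpolyC n R)) -(pv0 v) /meval rmorph_mmap.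
  by apply: eq_mmap.
pose P := mmap (polyC \o @mpolyC n R) (fun i : 'I_n =>
  if (i < k)%N then ('X_i)%:P else if i == k :> nat then 'X else (v i)%:MP%:P) p.
have Py (y : {mpoly R[n]}) : P.[y] = mmap (@mpolyC n R) (fun i : 'I_n =>
    if (i < k)%N then 'X_i else if i == k :> nat then y else (v i)%:MP) p.
  rewrite -[LHS]/(horner_eval y P) rmorph_mmap; apply: eq_mmap => i /=.
    by rewrite /horner_eval hornerC.
  by rewrite /horner_eval; case: ifP => _; [|case: ifP => _]; rewrite ?hornerC ?hornerX.
have P0 : P = 0.
  apply: poly_natroots => // c; rewrite Py.
  rewrite -[RHS](IHk (ltnW k_n) (fun i => if i == k :> nat then c%:R else v i)).
  apply: eq_mmap => // i; case: ifP => // _; case: ifP => //= _.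
  by rewrite rmorph_nat.
have := Py 'X_(Ordinal k_n); rewrite P0 horner0 => ->.
apply: eq_mmap => // i; rewrite ltnS leq_eqVlt; case: ltngtP => //= eq_ik.
by congr 'X_(_); apply: val_inj.
Qed.

(** * Linear coordinates on the space of area vectors *)

Section Coordinates.
Variable n : nat.
Local Notation N := (ntriangles n).

(** Any family [h] indexed by triangles is allowed, so that one notion covers the variables, the
    points and the substitutions. The index is 1-based, as in [varA]. *)
Definition coordA (T : Type) (h : 'I_N -> T) (i : nat) : T :=
  h (lshift n.+1 (inord i.-1 : 'I_n.+1)).

Definition coordB (T : Type) (h : 'I_N -> T) (i : nat) : T :=
  h (rshift n.+1 (inord i.-1 : 'I_n.+1)).

Definition coordL (V : zmodType) (h : 'I_N -> V) (k : nat) : V :=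
  \sum_(1 <= i < k.+1) (coordA h i + coordB h i)
  - \sum_(k.+1 <= i < n.+2) (coordA h i + coordB h i).

Definition monsky_at (R : comNzRingType) (h : 'I_N -> R) : R :=
  monsky_form n (coordA h) (coordL h).

Definition cofactor_at (R : comNzRingType) (h : 'I_N -> R) : R :=
  \prod_(1 <= j < n) coordL h j.

Lemma eq_coordL (V : zmodType) (h h' : 'I_N -> V) k :
    (forall i, (0 < i <= n.+1)%N ->
       coordA h i + coordB h i = coordA h' i + coordB h' i) ->
  (k <= n.+1)%N -> coordL h k = coordL h' k.
Proof.
move=> eqh k_n; congr (_ - _); apply: eq_big_nat => i i_k; apply: eqh; lia.
Qed.

Lemma coordL_last (V : zmodType) (h : 'I_N -> V) : coordL h n.+1 = - coordL h 0%N.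
Proof.
rewrite /coordL [\sum_(n.+2 <= i < _) _]big_geq // [\sum_(1 <= i < 1) _]big_geq //.
by rewrite subr0 sub0r opprK.
Qed.

Lemma coordL_step (V : zmodType) (h : 'I_N -> V) k : (0 < k <= n.+1)%N ->
  coordL h k - coordL h k.-1 = (coordA h k + coordB h k) *+ 2.
Proof.
case: k => // k /= k_n; rewrite /coordL big_nat_recr //= [\sum_(k.+1 <= i < _) _]big_ltn //.
have cancel (s t u : V) : s + u - t - (s - (u + t)) = u *+ 2.
  by rewrite opprB addrA [u + t]addrC addrA subrK -addrA addrC addrA subrK mulr2n.
exact: cancel.
Qed.

Lemma coordL_telescope (V : zmodType) (h : 'I_N -> V) (l : nat -> V) k :
    (forall i, (0 < i <= n.+1)%N -> coordA h i + coordB h i = l i - l i.-1) ->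
  (k <= n.+1)%N -> coordL h k = l k *+ 2 - (l 0%N + l n.+1).
Proof.
move=> hl k_n; rewrite /coordL.
rewrite !(eq_big_nat _ _ (F1 := fun i => coordA h i + coordB h i)
  (F2 := fun i => l i - l i.-1)); try by move=> i i_k; apply: hl; lia.
rewrite !big_add1 /= !telescope_sumr // mulr2n opprB.
by rewrite addrACA -opprD.
Qed.

Lemma raddf_coordL (U V : zmodType) (g : {additive U -> V}) (h : 'I_N -> U) k :
  g (coordL h k) = coordL (g \o h) k.
Proof.
rewrite /coordL raddfB !(raddf_sum g).
by congr (_ - _); apply: eq_bigr => i _; rewrite raddfD.
Qed.

Lemma rmorph_monsky_at (R S : comNzRingType) (g : {rmorphism R -> S}) (h : 'I_N -> R) :
  g (monsky_at h) = monsky_at (g \o h).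
Proof.
rewrite /monsky_at rmorph_monsky_form; apply: eq_monsky_form => // j _.
exact: (raddf_coordL g).
Qed.

Lemma eq_monsky_at (R : comNzRingType) (h h' : 'I_N -> R) :
  h =1 h' -> monsky_at h = monsky_at h'.
Proof.
move=> eqh; apply: eq_monsky_form => [i _|j j_n]; first exact: eqh.
by apply: eq_coordL; [move=> i _; rewrite /coordA /coordB !eqh | exact: leqW].
Qed.

Lemma mmap_monsky_at (R' S : comNzRingType) (f : {rmorphism R' -> S}) (h : 'I_N -> S) :
  mmap f h (monsky_at (fun t => 'X_t : {mpoly R'[N]})) = monsky_at h.
Proof.
rewrite rmorph_monsky_at; apply: eq_monsky_at => t /=.
by rewrite mmapX mmap1U.
Qed.

Lemma meval_monsky_at (R : comNzRingType) (v : 'I_N -> R) :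
  (monsky_at (fun t => 'X_t : {mpoly R[N]})).@[v] = monsky_at v.
Proof. exact: (mmap_monsky_at idfun). Qed.

(** Moving [e] from [B_{n+1}] to [A_{n+1}] keeps every [L_k] and every other [A_i], so it varies the
    single coordinate [A_{n+1}] of the system [A, L]. *)
Definition bump_last (V : zmodType) (h : 'I_N -> V) (e : V) (t : 'I_N) : V :=
  h t + e *+ (t == lshift n.+1 ord_max) - e *+ (t == rshift n.+1 ord_max).

Lemma coordL_bump_last (V : zmodType) (h : 'I_N -> V) e k : (k <= n.+1)%N ->
  coordL (bump_last h e) k = coordL h k.
Proof.
apply: eq_coordL => i i_n; rewrite /coordA /coordB /bump_last.
rewrite !(inj_eq (@lshift_inj _ _)) !(inj_eq (@rshift_inj _ _)).
rewrite eq_lrshift eq_rlshift mulr0n subr0 addr0.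
by rewrite addrACA subrr addr0.
Qed.

Lemma coordA_bump_last (V : zmodType) (h : 'I_N -> V) e i : (0 < i <= n.+1)%N ->
  coordA (bump_last h e) i = coordA h i + e *+ (i == n.+1).
Proof.
move=> i_n; rewrite /coordA /bump_last eq_lrshift mulr0n subr0.
rewrite (inj_eq (@lshift_inj _ _)) -val_eqE /= inordK; last by lia.
by congr (_ + _ *+ nat_of_bool _); apply/eqP/eqP; lia.
Qed.

Lemma monsky_at_bump_last (R : comNzRingType) (h : 'I_N -> R) e :
  monsky_at (bump_last h e) = monsky_at h + 2 * cofactor_at h * e.
Proof.
rewrite /monsky_at (eq_monsky_form (L' := coordL h) (coordA_bump_last h e)); last first.
  by move=> j j_n; rewrite coordL_bump_last //; exact: leqW.
rewrite /monsky_form eqxx mulr1n [\sum_(1 <= i < _) _](eq_big_nat _ _ (F2 := fun i => coordA h i *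
  \prod_(0 <= j < n.+1 | (j != i.-1) && (j != i)) coordL h j)); last first.
  by move=> i i_n /=; case: eqP => [|_]; [lia | rewrite mulr0n addr0].
rewrite /cofactor_at; ring.
Qed.

(** [B_1] has coefficient 1 in each [L_k] with [k > 0]. Taking [e = L_j] therefore kills [L_j], and
    [h = 0], [e = -1] is the point where [B_1 = 1] and all else is zero. *)
Definition bump_first (V : zmodType) (h : 'I_N -> V) (e : V) (t : 'I_N) : V :=
  h t - e *+ (t == rshift n.+1 ord0).

Lemma coordL_bump_first (V : zmodType) (h : 'I_N -> V) e k : (0 < k <= n.+1)%N ->
  coordL (bump_first h e) k = coordL h k - e.
Proof.
move=> k_n.
have bumpE i : (0 < i <= n.+1)%N -> coordA (bump_first h e) i + coordB (bump_first h e) i =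
    coordA h i + coordB h i - e *+ (i == 1%N).
  move=> i_n; rewrite /coordA /coordB /bump_first eq_lrshift mulr0n subr0 addrA.
  rewrite (inj_eq (@rshift_inj _ _)) -val_eqE /= inordK; last by lia.
  by congr (_ - _ *+ nat_of_bool _); apply/eqP/eqP; lia.
rewrite /coordL big_ltn; last by lia.
rewrite [in RHS]big_ltn; last by lia.
rewrite bumpE //= mulr1n.
rewrite [\sum_(2 <= i < k.+1) _](eq_big_nat _ _
  (F2 := fun i => coordA h i + coordB h i)); last first.
  move=> i i_k; rewrite bumpE; last by lia.
  by case: eqP => [|_]; [lia | rewrite mulr0n subr0].
rewrite [\sum_(k.+1 <= i < _) _](eq_big_nat _ _
  (F2 := fun i => coordA h i + coordB h i)); last first.
  move=> i i_k; rewrite bumpE; last by lia.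
  by case: eqP => [|_]; [lia | rewrite mulr0n subr0].
by rewrite -!addrA; congr (_ + (_ + _)); rewrite addrC -!addrA.
Qed.

End Coordinates.

(** The equation [L_i - L_{i-1} = 2 (A_i + B_i)] determines [B_i], and [L_{n+1} = - L_0] fixes the
    remaining additive constant. *)
Lemma exists_point (n : nat) (F : numFieldType) (a L : nat -> F) :
    L n.+1 = - L 0%N ->
  exists v : 'I_(ntriangles n) -> F,
    [/\ forall i, (0 < i <= n.+1)%N -> coordA v i = a i
      & forall k, (k <= n.+1)%N -> coordL v k = L k].
Proof.
move=> Ln.
pose v (t : 'I_(ntriangles n)) := match split t with
  | inl i => a i.+1 | inr i => (L i.+1 - L i) / 2 - a i.+1 end.
have vA i : (0 < i <= n.+1)%N -> coordA v i = a i.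
  move=> i_n; rewrite /coordA /v (unsplitK (inl _)) inordK; last by lia.
  by rewrite prednK //; lia.
have vAB i : (0 < i <= n.+1)%N -> coordA v i + coordB v i = (L i - L i.-1) / 2.
  move=> i_n; rewrite vA // /coordB /v (unsplitK (inr _)) inordK; last by lia.
  by rewrite prednK ?[a i + _]addrC ?subrK //; lia.
exists v; split=> // k k_n; rewrite (coordL_telescope (l := fun i => L i / 2)) //.
  by rewrite Ln; field.
by move=> i i_n; rewrite vAB // mulrBl.
Qed.

(** * Irreducibility of the form, and divisibility by it *)

Section MonskyPolynomial.
Variables (n : nat) (F : numFieldType).
Local Notation N := (ntriangles n).
Local Notation R := {mpoly F[N]}.

Definition monsky_mpoly : R := monsky_at (fun t => 'X_t).
Local Notation f := monsky_mpoly.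
Local Notation L := (coordL (fun t : 'I_N => 'X_t : R)).

Lemma meval_monsky v : f.@[v] = monsky_at v.
Proof. exact: meval_monsky_at. Qed.

Lemma mmap_coordL (S : comNzRingType) (g : {rmorphism F -> S}) (h : 'I_N -> S) k :
  mmap g h (L k) = coordL h k.
Proof.
rewrite (raddf_coordL (mmap g h)) /coordL.
by congr (_ - _); apply: eq_bigr => i _; rewrite /coordA /coordB /= !mmapX !mmap1U.
Qed.

Lemma meval_coordL v k : (L k).@[v] = coordL v k.
Proof. exact: (mmap_coordL idfun). Qed.

Lemma coordL_neq0 j : (0 < j <= n.+1)%N -> L j != 0.
Proof.
move=> j_n; apply/eqP => /(congr1 (fun p : R => p.@[bump_first (fun=> 0) (-1)])).
rewrite meval_coordL coordL_bump_first // meval0 (_ : coordL _ _ = 0); last first.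
  by rewrite /coordL !big1 ?subr0 // => i _; rewrite /coordA /coordB addr0.
by rewrite sub0r opprK => /eqP; rewrite oner_eq0.
Qed.

(* Substituting [B_1 - L_j] for [B_1] sends [L_j] to [0] and is the identity
   modulo [L_j], so it computes the residue modulo [L_j] in a domain. *)
Lemma coordL_prime j (x y u : R) : (0 < j <= n)%N -> L j * u = x * y ->
  (exists w, x = L j * w) \/ (exists w, y = L j * w).
Proof.
move=> j_n xy.
pose s := mmap (@mpolyC N F) (bump_first (fun t => 'X_t : R) (L j)).
have s_mod (p : R) : s p = 0 -> exists w, p = L j * w.
  (* [P.[y]] is [p] with [B_1 - y] in place of [B_1], so [P.[L j] = s p] and [P.[0] = p]. If
     [s p = 0], then ['X - L j] divides [P], and evaluation at 0 gives the divisibility. *)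
  pose P := mmap (polyC \o @mpolyC N F)
    (bump_first (fun t : 'I_N => ('X_t : R)%:P) 'X) p.
  have PE y' : P.[y'] = mmap (@mpolyC N F) (bump_first (fun t => 'X_t : R) y') p.
    rewrite -[LHS]/(horner_eval y' P) rmorph_mmap.
    apply: eq_mmap => t /=; rewrite /horner_eval ?hornerC //.
    by rewrite /bump_first hornerD hornerN hornerMn hornerC hornerX.
  have P0 : P.[0] = p.
    rewrite PE -[RHS]mmap_id; apply: eq_mmap => // t.
    by rewrite /bump_first mul0rn subr0.
  rewrite /s -PE => /rootP/factor_theorem[Q PQ].
  exists (- Q.[0]); rewrite -P0 PQ hornerM hornerXsubC sub0r; ring.
have sL : s (L j) = 0.
  by rewrite /s mmap_coordL coordL_bump_first ?subrr //; lia.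
have sM (p q : R) : s (p * q) = s p * s q by exact: rmorphM.
have /eqP : s x * s y = 0 by rewrite -sM -xy sM sL mul0r.
by rewrite mulf_eq0 => /orP[] /eqP /s_mod; [left | right].
Qed.

(** The witness is the point with [L_k = k - j] for [k <= n], [A_j = 1] and the other [A_i] zero.
    There [L_j = 0], and only the term of [A_j], which omits [L_{j-1}] and [L_j], survives; it is
    nonzero. *)
Lemma coordL_ndvd j (u : R) : (0 < j < n)%N -> f <> L j * u.
Proof.
move=> j_n fLu.
pose lv k : F := if k == n.+1 then j%:R else k%:R - j%:R.
have lv_last : lv n.+1 = - lv 0%N by rewrite /lv eqxx /= sub0r opprK.
have lvE k : (k <= n)%N -> lv k = k%:R - j%:R.
  by move=> k_n; rewrite /lv; case: eqP => // ?; lia.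
have [v [vA vL]] := exists_point (fun i => (i == j)%:R) lv_last.
have: f.@[v] = 0.
  by rewrite fLu mevalM meval_coordL vL ?lvE ?subrr ?mul0r //; lia.
rewrite meval_monsky /monsky_at.
rewrite (eq_monsky_form (a' := fun i => (i == j)%:R) (L' := lv)) //; last first.
  by move=> k k_n; rewrite vL //; lia.
rewrite /monsky_form.
rewrite [\prod_(1 <= k < n.+1) _](@big_cat_nat _ _ _ j) /=; try by lia.
rewrite [\prod_(j <= k < n.+1) _]big_ltn; last by lia.
rewrite lvE ?subrr ?mul0r ?mulr0; last by lia.
rewrite [n.+1 == j](_ : _ = false) ?mul0r ?subr0; last by apply/eqP; lia.
rewrite (bigD1_seq j) ?iota_uniq ?mem_index_iota /=; [|by lia..].
rewrite eqxx mul1r [\sum_(i <- _ | _) _]big1_seq ?addr0; last first.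
  by move=> i /andP[i_j _]; rewrite (negbTE i_j) mul0r.
rewrite sub0r => /eqP; rewrite oppr_eq0 mulf_eq0 pnatr_eq0 /=.
apply/negP; rewrite prodf_seq_neq0; apply/allP => k.
rewrite mem_index_iota => k_n; apply/implyP => /andP[_ k_j].
by rewrite lvE ?subr_eq0 ?eqr_nat //; lia.
Qed.

(** A factor [g] of [f] is divisible by no [L_j] with [0 < j < n], so each of these primes can be
    cancelled from a multiple of [g]. The constant 2 is invertible, and cancellability ([canc])
    passes to products. *)
Lemma cancel_cofactor k (g g' p s : R) :
    g * g' = f -> (2 * cofactor_at (fun t => 'X_t : R)) ^+ k * p = g * s ->
  exists s', p = g * s'.
Proof.
move=> gf.
pose canc u := forall p s : R, u * p = g * s -> exists s', p = g * s'.
have cancM u v : canc u -> canc v -> canc (u * v).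
  by move=> cu cv q r; rewrite -mulrA => /cu[r'] /cv.
have canc1 : canc 1 by move=> q r; rewrite mul1r => ->; exists r.
suff: canc ((2 * cofactor_at (fun t => 'X_t : R)) ^+ k) by move=> /[apply].
elim: k => [|k IHk]; rewrite ?expr0 // exprS; apply: (cancM) => //.
apply: (cancM) => [q r q2|].
  exists ((2^-1)%:MP * r); rewrite mulrCA -q2 mulrA -(rmorph_nat (@mpolyC N F)).
  by rewrite -rmorphM mulVf ?pnatr_eq0 // rmorph1 mul1r.
rewrite /cofactor_at big_nat; apply: (big_ind canc canc1 cancM) => j j_n q r qr.
have j_n' : (0 < j <= n)%N by lia.
have [[w gw]|[w rw]] := coordL_prime j_n' qr.
  by case: (@coordL_ndvd j (w * g') j_n); rewrite -gf gw mulrA.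
exists w; apply: (mulfI (@coordL_neq0 j _)); first by lia.
by rewrite qr rw mulrCA.
Qed.

(** The Taylor expansion of [p] in the direction [A_{n+1}]. Its degree in ['X] is the degree of [p]
    in [A_{n+1}] with respect to the coordinates [A, L]. *)
Definition shift_last (p : R) : {poly R} :=
  mmap (polyC \o @mpolyC N F) (bump_last (fun t : 'I_N => ('X_t : R)%:P) 'X) p.

Lemma horner_shift_last p y :
  (shift_last p).[y] = mmap (@mpolyC N F) (bump_last (fun t => 'X_t : R) y) p.
Proof.
rewrite -[LHS]/(horner_eval y (shift_last p)) rmorph_mmap.
apply: eq_mmap => t /=; rewrite /horner_eval ?hornerC //.
by rewrite /bump_last hornerD hornerN hornerD !hornerMn hornerC hornerX.
Qed.

Lemma shift_lastM p q : shift_last (p * q) = shift_last p * shift_last q.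
Proof. exact: rmorphM. Qed.

Lemma shift_last0 p : (shift_last p).[0] = p.
Proof.
rewrite horner_shift_last -[RHS]mmap_id; apply: eq_mmap => // t.
by rewrite /bump_last !mul0rn subr0 addr0.
Qed.

Lemma meval_shift_last p v y :
  (map_poly (meval v) (shift_last p)).[y] = p.@[bump_last v y].
Proof.
rewrite -[LHS]/((horner_eval y \o map_poly (meval v)) (shift_last p)) rmorph_mmap.
apply: eq_mmap => t /=; rewrite /horner_eval /=.
  by rewrite map_polyC /= hornerC mevalC.
rewrite /bump_last rmorphB rmorphD !rmorphMn /= map_polyC map_polyX /=.
by rewrite mevalXU hornerD hornerN hornerD !hornerMn hornerC hornerX.
Qed.

Lemma shift_last_monsky :
  shift_last f = f%:P + (2 * cofactor_at (fun t => 'X_t : R))%:P * 'X.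
Proof.
rewrite /shift_last /monsky_mpoly (mmap_monsky_at (polyC \o @mpolyC N F)).
rewrite monsky_at_bump_last (rmorph_monsky_at polyC) rmorphM rmorph_nat.
congr (_ + 2 * _ * _); rewrite /cofactor_at rmorph_prod.
by apply: eq_bigr => j _; rewrite (raddf_coordL polyC).
Qed.

Lemma cofactor_neq0 : 2 * cofactor_at (fun t => 'X_t : R) != 0.
Proof.
rewrite mulf_neq0 //.
  by rewrite -(rmorph_nat (@mpolyC N F)) mpolyC_eq0 pnatr_eq0.
rewrite /cofactor_at prodf_seq_neq0; apply/allP => j; rewrite mem_index_iota => j_n /=.
by apply: coordL_neq0; lia.
Qed.

(** A factor free of [A_{n+1}] divides the coefficient of ['X] in [shift_last f], which is
    [2 L_1 ... L_{n-1}]. Cancelling this product shows that the factor divides 1. *)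
Lemma monsky_factor_unit (q1 q2 : R) :
  f = q1 * q2 -> (size (shift_last q1) <= 1)%N -> q1 \is a GRing.unit.
Proof.
move=> fq /size1_polyC q1C.
have q1E : shift_last q1 = q1%:P.
  by rewrite -[q1 in RHS]shift_last0 q1C hornerC.
have: shift_last f = q1%:P * shift_last q2 by rewrite fq shift_lastM q1E.
move/(congr1 (fun P : {poly R} => P`_1)).
rewrite shift_last_monsky coefD coefC add0r coefMX coefC /= coefCM => hq.
have [w /esym q1w] : exists s', 1 = q1 * s'.
  apply: (@cancel_cofactor 1 q1 q2 1 (shift_last q2)`_1) => //.
  by rewrite expr1 mulr1.
by apply/unitrPr; exists w.
Qed.

Lemma monsky_neq0 : f != 0.
Proof.
apply/eqP => f0; have := shift_last_monsky; rewrite f0.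
rewrite /shift_last rmorph0 add0r => /esym/eqP.
by rewrite mulf_eq0 polyX_eq0 polyC_eq0 (negbTE cofactor_neq0).
Qed.

Lemma monsky_nonunit : (0 < n)%N -> f \isn't a GRing.unit.
Proof.
move=> n_gt0; apply/negP => fU.
have [v [vA vL]] := @exists_point n F (fun=> 0) (fun=> 0) (esym (oppr0 _)).
have: (f / f).@[v] = 0.
  rewrite mevalM meval_monsky /monsky_at.
  rewrite (eq_monsky_form (a' := fun=> 0) (L' := fun=> 0)) => [||k k_n]; first last.
  - by rewrite vL // leqW.
  - exact: vA.
  by rewrite monsky_form_a0 big_ltn // !mul0r.
by rewrite divrr // meval1 => /eqP; rewrite oner_eq0.
Qed.

(** [shift_last f] has degree one, so one of the two factors has degree zero in ['X]. *)
Lemma monsky_irreducible : (0 < n)%N -> forall q1 q2 : R, f = q1 * q2 ->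
  q1 \is a GRing.unit \/ q2 \is a GRing.unit.
Proof.
move=> n_gt0 q1 q2 fq.
have /(congr1 (fun P : {poly R} => size P)) : shift_last f = shift_last q1 * shift_last q2.
  by rewrite fq shift_lastM.
have nz q : q != 0 -> shift_last q != 0.
  by apply: contra_neq => q0; rewrite -(shift_last0 q) q0 horner0.
have := monsky_neq0; rewrite {1}fq mulf_eq0 negb_or => /andP[/nz q1_n0 /nz q2_n0].
rewrite (size_mul q1_n0 q2_n0) shift_last_monsky addrC size_MXaddC polyC_eq0 size_polyC.
have /negbTE-> := cofactor_neq0.
rewrite andFb (_ : nat_of_bool (~~ false) = 1%N) //.
move=> sz; have s1 : (0 < size (shift_last q1))%N by rewrite size_poly_gt0.
have s2 : (0 < size (shift_last q2))%N by rewrite size_poly_gt0.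
have aux (a b : nat) : 2 = (a + b).-1 -> (0 < a -> 0 < b -> a <= 1 \/ b <= 1)%N by lia.
have [sz1|sz2] := aux _ _ sz s1 s2.
  by left; apply: monsky_factor_unit fq sz1.
by right; apply: monsky_factor_unit sz2; rewrite fq mulrC.
Qed.

(** From a point where no [L_j] vanishes, changing [A_{n+1}] by [- f / h] leads to a zero of [f]
    with the same [L_j], where [p] vanishes. Hence [Hom] is zero. All its terms but the first
    contain [f], and the first is [h ^+ d * p]; so [f] divides [h ^+ d * p], and [h ^+ d]
    cancels. *)
Lemma monsky_dvd (p : R) :
    (forall v, (forall j, (j <= n)%N -> coordL v j != 0) -> f.@[v] = 0 -> p.@[v] = 0) ->
  exists s, p = f * s.
Proof.
move=> pf0; pose h := 2 * cofactor_at (fun t => 'X_t : R).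
pose P := shift_last p; pose d := size P.
(* [Hom] is [h ^ d] times the value of [P] at [- f / h], where [f] vanishes. *)
pose Hom := \sum_(i < d) P`_i * (- f) ^+ i * h ^+ (d - i).
have Hom0 : Hom = 0.
  have [/eqP//|Pi0] := boolP (Hom == 0); exfalso.
  (* The product takes care of the points where some [L_j] is zero, about which the hypothesis on
     [p] says nothing. *)
  have : Hom * \prod_(0 <= j < n.+1) L j = 0.
    apply: meval_eq0 => [|v]; first exact: pchar_num.
    rewrite mevalM rmorph_prod.
    have [Lv|] := boolP (all (fun j => coordL v j != 0) (index_iota 0 n.+1)); last first.
      rewrite -has_predC => /hasP[j j_n /negPn/eqP Lv0].
      by rewrite (bigD1_seq j) ?iota_uniq //= (meval_coordL v j) Lv0 mul0r mulr0.
    have {}Lv j : (j <= n)%N -> coordL v j != 0.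
      by move=> j_n; apply: (allP Lv); rewrite mem_index_iota.
    have hv : h.@[v] = 2 * cofactor_at v.
      rewrite mevalM -(rmorph_nat (@mpolyC N F)) mevalC /cofactor_at rmorph_prod.
      by congr (_ * _); apply: eq_bigr => j _; exact: meval_coordL.
    have hv0 : h.@[v] != 0.
      rewrite hv mulf_neq0 ?pnatr_eq0 // prodf_seq_neq0; apply/allP => j.
      by rewrite mem_index_iota => j_n; apply: Lv; lia.
    pose y := - f.@[v] / h.@[v].
    have py : p.@[bump_last v y] = 0.
      apply: pf0 => [j j_n|]; first by rewrite coordL_bump_last ?Lv // leqW.
      rewrite meval_monsky monsky_at_bump_last -hv -meval_monsky /y.
      by rewrite mulrCA mulfV // mulr1 subrr.
    suff -> : Hom.@[v] = h.@[v] ^+ d * p.@[bump_last v y] by rewrite py mulr0 mul0r.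
    rewrite -meval_shift_last -/P (horner_coef_wide (n := d)); last exact: size_poly.
    rewrite big_distrr rmorph_sum; apply: eq_bigr => i _.
    rewrite /= 2!mevalM !(rmorphXn (meval v)) /= mevalN coef_map /= /y expr_div_n.
    have -> : h.@[v] ^+ d = h.@[v] ^+ (d - i) * h.@[v] ^+ i.
      by rewrite -exprD subnK // ltnW.
    by rewrite mulrACA [_ * (_ / _)]mulrCA divff ?expf_neq0 // mulr1 mulrC mulrA.
  move/eqP; rewrite mulf_eq0 (negbTE Pi0) prodf_seq_eq0 => /hasP[j].
  rewrite mem_index_iota => j_n; case: j j_n => [_|j j_n /eqP]; last first.
    by apply/eqP/coordL_neq0; lia.
  (* [coordL_neq0] starts at index 1, so [L_0] is replaced by [- L_{n+1}]. *)
  by rewrite -[L 0%N]opprK -coordL_last oppr_eq0; apply/negP/coordL_neq0; lia.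
have [d0|d_gt0] := posnP d.
  exists 0; rewrite mulr0 -[p]shift_last0; move/eqP: d0; rewrite size_poly_eq0 => /eqP.
  by rewrite -/P => ->; rewrite horner0.
apply: (@cancel_cofactor d f 1 p (\sum_(1 <= i < d) P`_i * (- f) ^+ i.-1 * h ^+ (d - i))).
  by rewrite mulr1.
have : p = P`_0 by rewrite -horner_coef0 shift_last0.
move: Hom0; rewrite /Hom -(big_mkord xpredT (fun i => P`_i * (- f) ^+ i * h ^+ (d - i))).
rewrite big_ltn // expr0 mulr1 subn0 => /eqP; rewrite addr_eq0 => /eqP Hom0 ->.
rewrite -/h mulrC Hom0 big_distrr /= -sumrN; apply: eq_big_nat => -[//|i] _ /=.
by rewrite exprS [- f * _]mulNr mulrN mulNr opprK mulrCA -!mulrA.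
Qed.

End MonskyPolynomial.

(** * Area vectors of drawings and the zeros of the form *)

Lemma det22 (R : comPzRingType) (M : 'M[R]_2) : \det M = M 0 0 * M 1 1 - M 0 1 * M 1 0.
Proof.
rewrite (expand_det_row _ ord0) !big_ord_recl big_ord0 addr0 /cofactor !det_mx11 !mxE.
rewrite expr0 expr1 mul1r mulN1r mulrN.
by congr (M _ _ * M _ _ - M _ _ * M _ _); apply: val_inj.
Qed.

Section Geometry.
Variable K : realType.
Local Notation C := (K[i]%C).

Definition det2 (u v : 'cV[C]_2) : C := u 0 0 * v 1 0 - v 0 0 * u 1 0.

Lemma signed_areaE (u v w : 'cV[C]_2) : signed_area u v w = det2 (v - u) (w - u) / 2.
Proof.
rewrite /signed_area; congr (_ / 2).
(* Entries indexed by natural numbers reduce by computation after the cofactor expansion. *)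
pose e (i j : nat) : C := if i is i.+1
  then (if j is j.+1 then if j is 0 then v else w else u) (inord i : 'I_2) 0 else 1.
rewrite (_ : col_mx _ _ = (\matrix_(i, j) e i j : 'M_(1 + 2, 1 + (1 + 1)))); last first.
  apply/matrixP => i j; rewrite [RHS]mxE.
  have [i' ->|i' ->] := split_ordP i.
    by rewrite col_mxEu mxE ord1.
  rewrite col_mxEd; have [j' ->|j' ->] := split_ordP j.
    by rewrite row_mxEl ord1 /= inord_val.
  rewrite row_mxEr; have [j'' ->|j'' ->] := split_ordP j'.
    by rewrite row_mxEl ord1 /= inord_val.
  by rewrite row_mxEr ord1 /= inord_val.
rewrite (expand_det_row _ ord0) !big_ord_recl big_ord0 /cofactor !det22 !mxE /=.
have i0 : inord 0 = 0 :> 'I_2 by apply/val_inj; rewrite /= inordK.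
have i1 : inord 1 = 1 :> 'I_2 by apply/val_inj; rewrite /= inordK.
rewrite /e /bump /= i0 i1 /det2 !mxE; ring.
Qed.

Lemma halfD (u : 'cV[C]_2) : 2^-1 *: u + 2^-1 *: u = u.
Proof. by rewrite -scalerDl (_ : _ + _ = 1) ?scale1r //; field. Qed.

Section Areas.
Variable n : nat.
Local Notation N := (ntriangles n).
Implicit Types (rho : vertex n -> 'cV[C]_2) (y : 'I_N -> C).

Definition diag_point rho (k : nat) : 'cV[C]_2 := rho (p_ (inord k)).

Lemma diag_point0 rho : diag_point rho 0 = rho cornerP.
Proof. by congr (rho (p_ _)); apply: val_inj; rewrite /= inordK. Qed.

Lemma diag_point_last rho : diag_point rho n.+1 = rho cornerR.
Proof. by congr (rho (p_ _)); apply: val_inj; rewrite /= inordK. Qed.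

Lemma coordA_areas rho i : (0 < i <= n.+1)%N ->
  coordA (areas rho) i =
  det2 (diag_point rho i.-1 - rho cornerS) (diag_point rho i - rho cornerS) / 2.
Proof.
case: i => // i i_n; rewrite /coordA /areas /triangle (unsplitK (inl _)) signed_areaE /=.
have ri : nat_of_ord (inord i : 'I_n.+1) = i by rewrite inordK.
by congr (det2 (rho (p_ _) - _) (rho (p_ _) - _) / 2); apply: val_inj;
   rewrite /= ?/bump /= ri inordK // ltnW.
Qed.

Lemma coordB_areas rho i : (0 < i <= n.+1)%N ->
  coordB (areas rho) i =
  det2 (diag_point rho i - rho cornerQ) (diag_point rho i.-1 - rho cornerQ) / 2.
Proof.
case: i => // i i_n; rewrite /coordB /areas /triangle (unsplitK (inr _)) signed_areaE /=.
have ri : nat_of_ord (inord i : 'I_n.+1) = i by rewrite inordK.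
by congr (det2 (rho (p_ _) - _) (rho (p_ _) - _) / 2); apply: val_inj;
   rewrite /= ?/bump /= ri inordK // ltnW.
Qed.

(** If [q <> 0], some [X] has [[q, X] <> 0], and the telescoped identity gives the claim. If [Q]
    lies at the centre, all [L_k] vanish: for [n > 1] every term of the form contains one of them,
    and for [n = 1] the two areas [A_1] and [A_2] agree. *)
Lemma monsky_at_areas rho (c : C) y : (0 < n)%N ->
    rho cornerP + rho cornerR = rho cornerQ + rho cornerS ->
    (forall t, y t = c * areas rho t) ->
  monsky_at y = 0.
Proof.
move=> n_gt0 par yE.
pose ctr : 'cV[C]_2 := 2^-1 *: (rho cornerP + rho cornerR).
pose q := rho cornerQ - ctr; pose w k := diag_point rho k - ctr.
have two0 : (2 : C) != 0 by rewrite pnatr_eq0.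
have SE : rho cornerS = ctr - q.
  by rewrite /q opprB addrA halfD par addrC addKr.
have QE : rho cornerQ = ctr + q by rewrite /q addrC subrK.
have wS k : diag_point rho k - rho cornerS = w k + q by rewrite SE opprB addrCA addrC /w.
have wQ k : diag_point rho k - rho cornerQ = w k - q by rewrite QE opprD addrA.
have w_last : w n.+1 = - w 0%N.
  apply/eqP; rewrite -addr_eq0 /w diag_point_last diag_point0 addrACA -opprD.
  by rewrite halfD [rho cornerR + _]addrC subrr.
have aE i : (0 < i <= n.+1)%N -> coordA y i = c * (det2 (w i.-1 + q) (w i + q) / 2).
  by move=> i_n; rewrite {1}/coordA yE -/(coordA (areas rho) i) coordA_areas // !wS.
have abE i : (0 < i <= n.+1)%N ->
    coordA y i + coordB y i = c * det2 q (w i) - c * det2 q (w i.-1).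
  move=> i_n; rewrite aE // {1}/coordB yE -/(coordB (areas rho) i) coordB_areas // !wQ.
  by rewrite /det2 !mxE; field.
have LE k : (k <= n.+1)%N -> coordL y k = 2 * c * det2 q (w k).
  move=> k_n; rewrite (coordL_telescope abE) // w_last /det2 !mxE; ring.
have scaled (X : 'cV[C]_2) : 4 * det2 q X * monsky_at y = 0.
  rewrite (monsky_form_telescope (xi := fun k => det2 (w k + q) X)) ?coordL_last //.
    (* As [w_{n+1} = - w_0], the sum [xi_0 + xi_{n+1}] is [2 [q, X]], half of [d = 4 [q, X]]. *)
    rewrite w_last -[RHS](mulr0 (\prod_(1 <= j < n.+1) coordL y j)); congr (_ * _).
    by rewrite /det2 !mxE; ring.
  move=> i i_n; rewrite aE // !LE; try by lia.
  by rewrite /det2 !mxE; field.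
have four0 : (4 : C) != 0 by rewrite pnatr_eq0.
have [-> //|f_neq0] := eqVneq (monsky_at y) 0.
have q0 : q = 0.
  have qX X : det2 q X = 0.
    by apply/eqP; have /eqP := scaled X; rewrite !mulf_eq0 (negbTE f_neq0) (negbTE four0) orbF.
  have := qX (delta_mx 1 0); have := qX (delta_mx 0 0).
  rewrite /det2 ![delta_mx _ _ _ _]mxE /= !mulr0 mul1r mulr1 mul0r sub0r subr0.
  move=> /eqP; rewrite oppr_eq0 => /eqP q1 q00; apply/colP => i; rewrite [RHS]mxE.
  case: i => [[|[|//]] i2]; [rewrite -q00 | rewrite -q1]; congr (q _ _); exact: val_inj.
have L0 k : (k <= n)%N -> coordL y k = 0.
  by move=> k_n; rewrite LE ?q0 /det2 ?mxE ?mul0r ?mulr0 ?subrr ?mulr0 //; exact: leqW.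
rewrite /monsky_at (eq_monsky_form (a' := coordA y) (L' := fun=> 0)) //.
have [n1|n_gt1] : n = 1%N \/ (1 < n)%N by lia.
  have := aE 1%N isT; have := aE n.+1; rewrite w_last leqnn q0 !addr0 /= => /(_ isT).
  move: (coordA y) (w) => a w' a_last a1.
  rewrite /monsky_form; rewrite n1 in a_last *.
  rewrite !big_nat1 [\prod_(1 <= j < 1) _]big_geq // prod_skip2 // !big_geq // a1 a_last.
  by rewrite /det2 !mxE; field.
rewrite /monsky_form big_ltn // [\prod_(1 <= j < n) _]big_ltn // !mul0r !mulr0 subr0.
rewrite big1_seq ?mulr0 ?subr0 // => i; rewrite mem_index_iota /= => i_n.
rewrite prod_skip2 //; case: (posnP i.-1) => [i1|i1]; last by rewrite big_ltn // !mul0r mulr0.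
by rewrite [\prod_(i.+1 <= j < _) _]big_ltn ?mul0r ?mulr0 //; lia.
Qed.

(** The drawing keeps the corners at [z1, ..., z4]. In the basis [q, r] the vertex [p_k] is placed
    so that [[w_k + q, r] = g_k d] and [[q, w_k] = (L_k / L_0) d]; thus [g] is the sequence [xi] for
    [X = r], divided by [d]. It starts at 1, which puts [p_0] at [z1], and the equation makes it end
    at 1, which puts [p_{n+1}] at [z3]. *)
Lemma area_image_of_root (z1 z2 z3 z4 : 'cV[C]_2) y :
    nondegenerate_parallelogram z1 z2 z3 z4 -> (0 < n)%N ->
    (forall j, (j <= n)%N -> coordL y j != 0) -> monsky_at y = 0 ->
  area_image z1 z2 z3 z4 y.
Proof.
move=> [par]; rewrite signed_areaE => nd n_gt0 Ly fy.
have two0 : (2 : C) != 0 by rewrite pnatr_eq0.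
pose O : 'cV[C]_2 := 2^-1 *: (z1 + z3).
pose q := z2 - O; pose r := z1 - O.
have z4E : z4 = z3 + z1 - z2.
  by apply/eqP; rewrite -addrA -opprB par opprB addrC subrK.
pose d := det2 q r.
have d0 : d != 0.
  apply: contra nd => /eqP d0; apply/eqP.
  have -> : det2 (z2 - z1) (z3 - z1) = - 2 * d by rewrite /d /det2 /q /r /O !mxE; field.
  by rewrite d0 mulr0 mul0r.
have L00 : coordL y 0%N != 0 by exact: Ly.
pose L := coordL y.
pose g := fix g k := if k is k.+1 then (L k.+1 * g k - 4 * coordA y k.+1) / L k else 1.
have gE i : (0 < i <= n.+1)%N -> 4 * coordA y i = L i * g i.-1 - L i.-1 * g i.
  case: i => // i i_n /=; have : L i != 0 by apply: Ly.
  by move=> ?; field.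
have g_last : g n.+1 = 1.
  have := monsky_form_telescope n_gt0 (coordL_last y) gE.
  rewrite -/(monsky_at y) fy mulr0 => /esym/eqP; rewrite mulf_eq0 prodf_seq_eq0.
  case/orP => [/hasP[j]|/eqP g2].
    by rewrite mem_index_iota => j_n; rewrite (negbTE (Ly _ _)) //; lia.
  have /eqP : 2 * (1 - g n.+1) = 0 by rewrite -g2 /=; ring.
  by rewrite mulf_eq0 (negbTE two0) subr_eq0 => /eqP.
pose rho (v : vertex n) := match v with
  | p_ k => O + (g k - 1) *: q + (L k / L 0%N) *: r
  | cornerQ => z2 | cornerS => z4 end.
have rhoE k : (k <= n.+1)%N ->
    diag_point rho k = O + (g k - 1) *: q + (L k / L 0%N) *: r.
  by move=> k_n; rewrite /diag_point /= inordK.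
(* The determinant for [A_i] is [(L_i g_{i-1} - L_{i-1} g_i) d / L_0 = 4 A_i d / L_0], and an area
   is half of it. *)
pose c := L 0%N / (2 * d).
have c0 : c != 0 by rewrite mulf_neq0 ?invr_eq0 ?mulf_neq0.
have rA i : (0 < i <= n.+1)%N -> coordA y i = c * coordA (areas rho) i.
  move=> i_n; apply: (mulfI (_ : 4 != 0 :> C)); first by rewrite pnatr_eq0.
  rewrite gE // coordA_areas // !rhoE /=; try by lia.
  rewrite (_ : det2 _ _ = (g i.-1 * (L i / L 0%N) - g i * (L i.-1 / L 0%N)) * d).
    rewrite /c; field; by rewrite d0 L00.
  by rewrite /d /det2 z4E /q /r /O !mxE; field.
have rB i : (0 < i <= n.+1)%N -> coordB y i = c * coordB (areas rho) i.
  move=> i_n; have /eqP := coordL_step y i_n.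
  rewrite mulr2n => LL.
  apply: (mulfI (_ : 4 != 0 :> C)); first by rewrite pnatr_eq0.
  (* [B_i] is recovered from [A_i] and [L_i - L_{i-1} = 2 (A_i + B_i)]. *)
  have -> : 4 * coordB y i = 2 * (L i - L i.-1) - 4 * coordA y i by rewrite (eqP LL); ring.
  rewrite gE // coordB_areas // !rhoE /=; try by lia.
  rewrite (_ : det2 _ _ = ((g i - 2) * (L i.-1 / L 0%N) - (g i.-1 - 2) * (L i / L 0%N)) * d).
    rewrite /c; field; by rewrite d0 L00.
  by rewrite /d /det2 /q /r /O !mxE; field.
have areaE t : y t = c * areas rho t.
  have [i ->|i ->] := split_ordP t.
    have := rA i.+1; rewrite /coordA /= inord_val; apply; exact: ltn_ord.
  have := rB i.+1; rewrite /coordB /= inord_val; apply; exact: ltn_ord.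
split.
  have [t yt|y0] := pickP (fun t => y t != 0); first by exists t.
  have {}y0 t : y t = 0 by apply/eqP/negbFE/y0.
  case/eqP: L00; rewrite /coordL !big1 ?subr0 // => i _;
    by rewrite /coordA /coordB !y0 addr0.
exists rho, c; split=> //.
exists 1%:M, 0; rewrite !mul1mx !addr0; split=> //.
- by rewrite -diag_point0 rhoE //= subrr scale0r addr0 divff // scale1r /r addrC subrK.
- rewrite -diag_point_last rhoE // g_last subrr scale0r addr0 /L coordL_last.
  rewrite mulNr divff // scaleN1r.
  by rewrite /r opprB addrA halfD addrC addKr.
Qed.

End Areas.

End Geometry.

(** * Homogeneity of degree [n] *)

Section Homogeneity.
Variables (n : nat) (R : comNzRingType).
Local Notation S := {mpoly R[ntriangles n]}.

Lemma dhomog_coordL k : coordL (fun t => 'X_t : S) k \is 1.-homog.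
Proof.
have X1 t : ('X_t : S) \is 1.-homog by rewrite dhomogX /= mdeg1.
by rewrite rpredB // rpred_sum // => i _; rewrite rpredD // /coordA /coordB.
Qed.

Lemma dhomog_prod_coordL a b :
  \prod_(a <= j < b) coordL (fun t => 'X_t : S) j \is (b - a).-homog.
Proof.
elim: b => [|b IHb]; first by rewrite big_geq // dhomog1.
have [ab|ba] := leqP a b; last by rewrite big_geq // (eqP (ba : b.+1 - a == 0)%N) dhomog1.
by rewrite big_nat_recr // subSn // -addn1; apply: dhomogM => //; exact: dhomog_coordL.
Qed.

Lemma dhomog_monsky : (0 < n)%N -> monsky_at (fun t => 'X_t : S) \is n.-homog.
Proof.
move=> n_gt0; rewrite /monsky_at /monsky_form mulr_natl.
have A1 i : coordA (fun t => 'X_t : S) i \is 1.-homog by rewrite dhomogX /= mdeg1.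
rewrite rpredB ?rpredMn ?rpredB //.
- by have := dhomog_prod_coordL 1 n.+1; rewrite subSS subn0.
- rewrite big_nat rpred_sum // => i i_n; rewrite prod_skip2; last by lia.
  have := dhomogM (A1 i) (dhomogM (dhomog_prod_coordL 0 i.-1) (dhomog_prod_coordL i.+1 n.+1)).
  by rewrite (_ : (1 + _)%N = n) //; lia.
- by have := dhomogM (A1 n.+1) (dhomog_prod_coordL 1 n); rewrite subnKC.
Qed.

End Homogeneity.

(** * Primitivity, uniqueness up to sign, and the degree *)

(** At [B_1 = 1] all [A_i] vanish and each [L_j] with [j > 0] is 1, so only the leading product
    remains. This value gives primitivity and later identifies the scalar in the uniqueness
    proof. *)
Lemma monsky_unit_point (R : comNzRingType) n :
  monsky_at (bump_first (fun=> 0) (-1) : 'I_(ntriangles n) -> R) = 1.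
Proof.
set v := bump_first _ _.
rewrite /monsky_at (eq_monsky_form (a' := fun=> 0) (L' := coordL v)) // => [|i i_n].
  rewrite monsky_form_a0 big_nat big1 // => j j_n; rewrite coordL_bump_first; last by lia.
  by rewrite /coordL !big1 ?subrr ?sub0r ?opprK // => i _; rewrite /coordA /coordB addr0.
by rewrite /coordA /v /bump_first eq_lrshift mulr0n subr0.
Qed.

Lemma dvdz_meval m (d : int) (q : {mpoly int[m]}) v :
  (forall e, (d %| q@_e)%Z) -> (d %| q.@[v])%Z.
Proof. by move=> dq; rewrite mevalE rpred_sum // => e _; rewrite dvdz_mulr. Qed.

Lemma dvdz1_unit (d : int) : (d %| 1)%Z -> d \is a GRing.unit.
Proof. by case/dvdzP=> k dk; apply/unitrPr; exists k; rewrite mulrC. Qed.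

Section Uniqueness.
Variables (K : realType) (n : nat) (z1 z2 z3 z4 : 'cV[K[i]%C]_2).
Local Notation C := (K[i]%C).
Local Notation N := (ntriangles n).
Hypotheses (n_gt0 : (0 < n)%N) (hz : nondegenerate_parallelogram z1 z2 z3 z4).

Local Notation f := (monsky_at (fun t => 'X_t : {mpoly int[N]})).

Lemma map_monsky : map_mpoly intr f = monsky_mpoly n C.
Proof. exact: (mmap_monsky_at (@mpolyC N C \o intr)). Qed.

Lemma meval_map_intr (p : {mpoly int[N]}) v :
  (map_mpoly intr p).@[fun t => (v t)%:~R] = (p.@[v])%:~R :> C.
Proof.
rewrite /map_mpoly (rmorph_mmap (meval _)) /meval [RHS](rmorph_mmap (@intmul C 1)).
by apply: eq_mmap => t /=; rewrite ?mevalC ?mevalXU.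
Qed.

Lemma area_image_sub_variety y :
  area_image z1 z2 z3 z4 y -> area_variety (n := n) z1 z2 z3 z4 y.
Proof. by move=> im_y; split=> [|d q _]; [case: im_y | apply]. Qed.

Lemma monsky_variety y :
  area_variety z1 z2 z3 z4 y -> (monsky_mpoly n C).@[y] = 0.
Proof.
case=> _ /(_ n (monsky_mpoly n C)); apply; first exact: dhomog_monsky.
move=> x [_ [rho [c [[M [b [EP EQ ER ES]]] _ xE]]]]; rewrite meval_monsky.
(* In this form the parallelogram relation passes through every affine map, singular ones
   included. *)
have z13 : z1 + z3 = z2 + z4.
  case: hz => /(congr1 (fun u => u + (z1 + z4))) + _.
  by rewrite addrA subrK [z1 + z4]addrC addrA subrK => ->; exact: addrC.
apply: (monsky_at_areas n_gt0 _ xE).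
by rewrite EP EQ ER ES addrACA [RHS]addrACA -!mulmxDr z13.
Qed.

Lemma is_monsky : is_monsky_polynomial z1 z2 z3 z4 f.
Proof.
split.
- by exists n; exact: dhomog_monsky.
- rewrite map_monsky; split; first exact: monsky_neq0.
    exact: monsky_nonunit.
  exact: monsky_irreducible.
- by rewrite map_monsky; exact: monsky_variety.
- move=> d dq; have := dvdz_meval (bump_first (fun=> 0) (-1)) dq.
  by rewrite meval_monsky_at monsky_unit_point => /dvdz1_unit.
Qed.

Lemma is_monskyN (p : {mpoly int[N]}) :
  is_monsky_polynomial z1 z2 z3 z4 p -> is_monsky_polynomial z1 z2 z3 z4 (- p).
Proof.
case=> -[d hp] [p0 pU pI] pV pP; split.
- by exists d; rewrite rpredN.
- rewrite rmorphN; split; rewrite ?oppr_eq0 ?unitrN // => q1 q2 /eqP.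
  rewrite eqr_oppLR -mulNr => /eqP/pI; rewrite unitrN; exact.
- by move=> y /pV yV; rewrite rmorphN mevalN yV oppr0.
- by move=> e he; apply: pP => m; have := he m; rewrite mcoeffN rpredN.
Qed.

(** Zeros of [f] with all [L_j] nonzero are area vectors, so [f] divides [p] over the complex
    numbers, and irreducibility of [p] makes the quotient constant. Evaluation at the point where
    [f] is 1 shows that this constant is an integer, and primitivity of [p] makes it [1] or [-1]. *)
Lemma monsky_unique (p : {mpoly int[N]}) :
  is_monsky_polynomial z1 z2 z3 z4 p -> p = f \/ p = - f.
Proof.
case=> _ [_ _ pI] pV pP.
have [s ps] : exists s, map_mpoly intr p = monsky_mpoly n C * s.
  apply: monsky_dvd => v Lv fv; apply: pV; apply: area_image_sub_variety.
  by apply: area_image_of_root => //; rewrite -meval_monsky.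
have [fU|/andP[/eqP sE _]] := pI _ _ ps.
  by have := @monsky_nonunit n C n_gt0; rewrite fU.
pose v : 'I_N -> int := bump_first (fun=> 0) (-1).
have fv : f.@[v] = 1 by rewrite meval_monsky_at monsky_unit_point.
have sk : s@_0 = (p.@[v])%:~R.
  rewrite -meval_map_intr ps mevalM -map_monsky meval_map_intr fv mul1r.
  by rewrite sE mevalC mcoeffC eqxx mulr1.
have pk : p = p.@[v] *: f.
  apply/mpolyP => e; apply: (@intr_inj C).
  rewrite -mcoeff_map_mpoly ps sE sk -map_monsky mulrC mul_mpolyC.
  by rewrite mcoeffZ mcoeff_map_mpoly mcoeffZ intrM.
move: pk; move: p.@[v] => k pk.
have /pP : forall e, (k %| p@_e)%Z by move=> e; rewrite pk mcoeffZ dvdz_mulr.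
by case/orP=> /eqP kE; [left | right]; rewrite pk kE ?scale1r ?scaleN1r.
Qed.

Lemma msize_monsky (p : {mpoly int[N]}) : p = f \/ p = - f -> (msize p).-1 = n.
Proof.
have f0 : f != 0.
  apply/eqP => f0; have := monsky_neq0 n C.
  by rewrite -map_monsky f0 rmorph0 eqxx.
have fn := dhomog_monsky int n_gt0.
have fs := dhomog_uniq f0 (dhomog_msize fn) fn.
by case=> ->; rewrite ?msizeN.
Qed.

End Uniqueness.

Local Open Scope complex_scope.

Theorem theorem25 (K : realType) (n : nat) (hn : (1 <= n)%N)
    (z1 z2 z3 z4 : 'cV[K[i]]_2)
    (hz : nondegenerate_parallelogram z1 z2 z3 z4) :
  let f : {mpoly int[ntriangles n]} :=
    \prod_(1 <= j < n.+1) formL n j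
    - 2 * (\sum_(1 <= i < n.+1)
             varA n i * (\prod_(0 <= j < n.+1 | (j != i.-1) && (j != i)) formL n j)
           - varA n n.+1 * \prod_(1 <= j < n) formL n j) in
  (forall p : {mpoly int[ntriangles n]},
     is_monsky_polynomial z1 z2 z3 z4 p <-> p = f \/ p = - f) /\
  (forall p : {mpoly int[ntriangles n]},
     is_monsky_polynomial z1 z2 z3 z4 p -> (msize p).-1 = n).
Proof.
(* [varA], [varB] and [formL] are [coordA], [coordB] and [coordL] at the variables, up to
   conversion. *)
move=> f; have fE : f = monsky_at (fun t => 'X_t) by [].
have uniq p : is_monsky_polynomial z1 z2 z3 z4 p -> p = f \/ p = - f.
  by rewrite fE; exact: monsky_unique.
split=> p; last by move/uniq; rewrite fE; exact: msize_monsky.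
split=> [/uniq //|]; rewrite fE => -[] ->; first exact: is_monsky.
by apply: is_monskyN; exact: is_monsky.
Qed.
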